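(* The spaces of lifts of twisted Grassmann $n$-gons and the spaces of matrix weights on the pentagram networks are related in the following ways. (a) There is a bijective map $\widetilde{\mathcal{TL}}_{n,N}/\mathrm{PGL}_{3N}\to\mathcal{E}_{n,N}$. (b) There is a bijective map $\widetilde{\mathcal{L}}_{n,N}/\mathrm{PGL}_{3N}\to\widetilde{\mathcal{E}}_{n,N}$. (Both maps send a lift to the weights given by the coefficients of its linear dependence relations.) (c) Under these identifications, the actions of $\mathcal{G}^\circ$ on $\widetilde{\mathcal{E}}_{n,N}$ and of $\mathcal{G}^\bullet$ on $\mathcal{E}_{n,N}$ correspond to changing the lift of a fixed polygon. (d) $\mathcal{GP}_{n,N}\cong\mathcal{E}_{n,N}/\mathcal{G}^\bullet\cong\widetilde{\mathcal{E}}_{n,N}/\mathcal{G}^\circ$.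
   Context: Polygons. $\mathrm{Gr}(N,3N)$ is the Grassmannian of $N$-dimensional subspaces of $\mathbb{R}^{3N}$; points are represented by rank-$N$ real $3N\times N$ matrices up to right multiplication by $\mathrm{GL}_N$. A twisted Grassmann $n$-gon is a sequence $(p_i)_{i\in\mathbb{Z}}$ in $\mathrm{Gr}(N,3N)$ with $p_{i+n}=Mp_i$ for all $i$, with monodromy $M\in\mathrm{PGL}_{3N}$. A lift is a sequence $V=(V_i)_{i\in\mathbb{Z}}$ of $3N\times N$ matrices with column spans $p_i$; it is twisted if $V_{i+n}=MV_i$ for all $i$ with $M\in\mathrm{GL}_{3N}$ representing the monodromy. Standing nondegeneracy assumption: each $3N\times 3N$ matrix $(V_i\,V_{i+1}\,V_{i+2})$ is invertible and in the linear dependence relation expressing $V_{i+3}$ through $V_i,V_{i+1},V_{i+2}$ (with $N\times N$ matrix coefficients on the right) all coefficients lie in $\mathrm{GL}_N$. $\mathcal{L}_{n,N}$ is the set of all lifts of twisted $n$-gons and $\mathcal{TL}_{n,N}$ the set of twisted lifts (viewed as tuples $(V_1,\dots,V_n,M)$, $M\in\mathrm{GL}_{3N}$). $\widetilde{\mathcal{L}}_{n,N}$, $\widetilde{\mathcal{TL}}_{n,N}$ are their quotients by the dilation action of $\mathbb{R}^*$ ($V_i\mapsto\lambda V_i$ for all $i$, $M$ unchanged); $\mathrm{PGL}_{3N}$ acts on them by $V_i\mapsto gV_i$, $M\mapsto gMg^{-1}$. $\mathcal{GP}_{n,N}$ is the moduli space of twisted $n$-gons up to $\mathrm{PGL}_{3N}$,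 i.e. the quotient of $\mathcal{TL}_{n,N}$ by the action of $\mathrm{GL}_{3N}$ and by changing the lift. Networks. The infinite network $\widetilde{Q}_n$ on an infinite cylinder has square faces indexed by $i\in\mathbb{Z}$; face $i$ has vertices $tl_i,tr_i,bl_i,br_i$ (top-left, top-right, bottom-left, bottom-right) and arrows $bl_i\to tl_i$ (left), $bl_i\to br_i$ (bottom), $tr_i\to br_i$ (right), $tl_i\to tr_i$ (top), together with connecting arrows $br_i\to tl_{i+1}$ and $tr_i\to bl_{i+2}$. $Q_n$ is the corresponding piece with $n$ faces on a cylinder, and $\widehat Q_n$ the corresponding network on a torus (indices mod $n$). $\widetilde{\mathcal{E}}_{n,N}$ is the space of all choices of $\mathrm{GL}_N$-weights $\alpha_i,\beta_i,\gamma_i$ on the left, bottom and right edges of all the square faces $i\in\mathbb{Z}$ of $\widetilde Q_n$ (all other edges having weight $\mathrm{Id}_N$); $\mathcal{E}_{n,N}\cong\mathrm{GL}_N^{3n}$ is the same for $Q_n$, identified with the $n$-periodic weights in $\widetilde{\mathcal{E}}_{n,N}$. The weights associated to a lift $(V_i)$ are defined by $$V_{i+3}=V_i\,\beta_i+V_{i+1}\,\alpha_{i+1}+V_{i+2}\,\gamma_i .$$ Gauge groups. A gauge transformation at a vertex with $A\in\mathrm{GL}_N$ multiplies all incoming weights by $A$ on the right and all outgoing weights by $A^{-1}$ on the left. $\mathcal{G}^\circ$ is the subgroup of the gauge group of $\widetilde Q_n$ preserving $\widetilde{\mathcal{E}}_{n,N}$; it is generated by the following transformations, one for each face $j$ and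 $X\in\mathrm{GL}_N$: $\alpha_j,\beta_{j-1},\gamma_{j-1}$ are multiplied by $X$ on the right, and $\gamma_j,\alpha_{j+2},\beta_{j+2}$ are multiplied by $X^{-1}$ on the left (simultaneous transformations at infinitely many faces allowed). $\mathcal{G}^\bullet\subset\mathcal{G}^\circ$ is the subgroup of $n$-periodic transformations, acting on $\mathcal{E}_{n,N}$.
   Formalization: In (b), (d) the infinite weights are those G°-equivalent to n-periodic ones ((b) also for all sequences and weights); GP consists of pairs (polygon, monodromy); E/G• → E~/G° is onto, bijective only where the monodromy is unique; G• allows periodicity up to a constant scalar. *)

(* Defs.v *)
From HB Require Import structures.
From mathcomp Require Import all_boot all_order all_algebra.
From mathcomp Require Import boolp classical_sets functions reals.

Set Implicit Arguments.
Unset Strict Implicit.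
Unset Printing Implicit Defensive.

Import Order.TTheory GRing.Theory Num.Theory.
Local Open Scope classical_set_scope.
Local Open Scope ring_scope.

(* A quotient is the set of its equivalence classes, so that equality of
   classes is Leibniz equality and [set_bij] applies directly. *)
Definition cls {T : Type} (A : set T) (e : T -> T -> Prop) (x : T) : set T :=
  [set y | A y /\ e x y].
Definition quot {T : Type} (A : set T) (e : T -> T -> Prop) : set (set T) :=
  cls A e @` A.

Definition GL (R : realType) (k : nat) : set 'M[R]_k := [set A | A \in unitmx].
Arguments GL {R} k.

Definition proportional (R : realType) (k : nat) (A B : 'M[R]_k) : Prop :=
  exists2 c : R, c != 0 & B = c *: A.
Definition PGL (R : realType) (k : nat) : set (set 'M[R]_k) :=
  quot (GL k) (@proportional R k).
Arguments PGL {R} k.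

(* 3N is written N + N + N, so that the block matrix (A B C) built from three
   3N x N matrices is a square matrix. A point of Gr(N, 3N) is the set of all
   rank N matrices representing it. *)
Definition Gr (R : realType) (N : nat) : set (set 'M[R]_(N + N + N, N)) :=
  quot [set A : 'M[R]_(N + N + N, N) | \rank A = N]
       (fun A B => exists2 X : 'M[R]_N, GL N X & B = A *m X).
Arguments Gr {R N}.

Definition polygon (R : realType) (N : nat) := int -> set 'M[R]_(N + N + N, N).
Definition lift_seq (R : realType) (N : nat) := int -> 'M[R]_(N + N + N, N).

Section Polygons.
Context {R : realType} {N : nat}.
Implicit Types (p : polygon R N) (V : lift_seq R N) (m : set 'M[R]_(N + N + N)).
Implicit Types (g M : 'M[R]_(N + N + N)) (n : nat).

Definition nondegenerate V : Prop := forall i : int,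
  row_mx (row_mx (V i) (V (i + 1))) (V (i + 2)) \in unitmx /\
  exists B A C : 'M[R]_N,
    [/\ GL N B, GL N A, GL N C &
        V (i + 3) = V i *m B + V (i + 1) *m A + V (i + 2) *m C].

Definition lift_of p V : Prop := forall i, p i (V i).

Definition is_monodromy n p m : Prop :=
  PGL (N + N + N) m /\
  forall M, m M -> forall i, p (i + n%:Z) = mulmx M @` p i.

Definition twisted_ngon n : set (polygon R N) :=
  [set p | [/\ forall i, Gr (p i),
               exists m, is_monodromy n p m &
               forall V, lift_of p V -> nondegenerate V]].

(* For N > 1 the sequence p need not determine its monodromy in PGL (the
   stabilizer of p in PGL may be nontrivial), so both the bare sequences and
   the pairs (polygon, monodromy) are needed. *)
Definition marked_ngon n : set (polygon R N * set 'M[R]_(N + N + N)) :=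
  [set P | twisted_ngon n P.1 /\ is_monodromy n P.1 P.2].
Definition rigid_ngon n p : Prop :=
  forall m m', is_monodromy n p m -> is_monodromy n p m' -> m = m'.

Definition all_lifts : set (lift_seq R N) := [set V | nondegenerate V].
Definition lifts n : set (lift_seq R N) :=
  [set V | exists2 p, twisted_ngon n p & lift_of p V].
(* The tuple (V_1, ..., V_n, M) is recorded as the whole sequence it generates,
   together with M. *)
Definition twisted_lifts n : set (lift_seq R N * 'M[R]_(N + N + N)) :=
  [set VM | [/\ lifts n VM.1, GL (N + N + N) VM.2 &
                forall i, VM.1 (i + n%:Z) = VM.2 *m VM.1 i]].
Definition twisted_lift_of n (P : polygon R N * set 'M[R]_(N + N + N))
    (VM : lift_seq R N * 'M[R]_(N + N + N)) : Prop :=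
  [/\ twisted_lifts n VM, lift_of P.1 VM.1 & P.2 VM.2].

Definition dilation V V' : Prop :=
  exists2 c : R, c != 0 & V' = (fun i => c *: V i).
Definition tdilation (X X' : lift_seq R N * 'M[R]_(N + N + N)) : Prop :=
  dilation X.1 X'.1 /\ X'.2 = X.2.

Definition actL g V : lift_seq R N := fun i => g *m V i.
Definition actTL g (VM : lift_seq R N * 'M[R]_(N + N + N)) :
    lift_seq R N * 'M[R]_(N + N + N) :=
  (actL g VM.1, g *m VM.2 *m invmx g).
Definition actP g p : polygon R N := fun i => mulmx g @` p i.
Definition actMP g (P : polygon R N * set 'M[R]_(N + N + N)) :
    polygon R N * set 'M[R]_(N + N + N) :=
  (actP g P.1, (fun M => g *m M *m invmx g) @` P.2).

(* Orbit relations for PGL, an element of which acts through any matrix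
   representing it: on points, and on dilation classes. *)
Definition pgl_orbit {T : Type} (act : 'M[R]_(N + N + N) -> T -> T)
    (x y : T) : Prop :=
  exists2 g, GL (N + N + N) g & y = act g x.
Definition pgl_orbit_cls {T : Type} (act : 'M[R]_(N + N + N) -> T -> T)
    (C D : set T) : Prop :=
  exists2 g, GL (N + N + N) g & D = act g @` C.

(* Modulo dilations first, then modulo PGL. *)
Definition all_lifts_modPGL := quot (quot all_lifts dilation) (pgl_orbit_cls actL).
Definition lifts_modPGL n := quot (quot (lifts n) dilation) (pgl_orbit_cls actL).
Definition twisted_lifts_modPGL n :=
  quot (quot (twisted_lifts n) tdilation) (pgl_orbit_cls actTL).

Definition all_lift_cls V :=
  cls (quot all_lifts dilation) (pgl_orbit_cls actL) (cls all_lifts dilation V).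
Definition lift_cls n V :=
  cls (quot (lifts n) dilation) (pgl_orbit_cls actL) (cls (lifts n) dilation V).
Definition twisted_lift_cls n (VM : lift_seq R N * 'M[R]_(N + N + N)) :=
  cls (quot (twisted_lifts n) tdilation) (pgl_orbit_cls actTL)
      (cls (twisted_lifts n) tdilation VM).

Definition GP n := quot (marked_ngon n) (pgl_orbit actMP).
Definition GP_cls n := cls (marked_ngon n) (pgl_orbit actMP).
Definition GP_rigid n := [set C | GP n C /\ forall P, C P -> rigid_ngon n P.1].

(* The variant of [GP] in which the monodromy is kept as a matrix in GL: twisted
   lifts modulo GL and modulo changes of lift that do not affect M. *)
Definition linear_equiv n (X X' : lift_seq R N * 'M[R]_(N + N + N)) : Prop :=
  exists2 g, GL (N + N + N) g &
    X'.2 = g *m X.2 *m invmx g /\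
    exists p, [/\ twisted_ngon n p, lift_of p (actL g X.1) & lift_of p X'.1].
Definition linearGP n := quot (twisted_lifts n) (linear_equiv n).
Definition linearGP_cls n := cls (twisted_lifts n) (linear_equiv n).

Definition bareGP n := quot (twisted_ngon n) (pgl_orbit actP).
Definition bareGP_cls n := cls (twisted_ngon n) (pgl_orbit actP).
Definition bareGP_rigid n := [set C | bareGP n C /\ forall p, C p -> rigid_ngon n p].

End Polygons.

Inductive corner := tl | tr | bl | br.
Inductive arrow := Left | Bottom | Right | Top | ToNext | ToNext2.

Definition vertex : Type := int * corner.
Definition edge : Type := int * arrow.

Definition source (e : edge) : vertex :=
  let: (i, a) := e in
  match a with
  | Left => (i, bl) | Bottom => (i, bl) | Right => (i, tr)
  | Top => (i, tl) | ToNext => (i, br) | ToNext2 => (i, tr)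
  end.
Definition target (e : edge) : vertex :=
  let: (i, a) := e in
  match a with
  | Left => (i, tl) | Bottom => (i, br) | Right => (i, br)
  | Top => (i, tr) | ToNext => (i + 1, tl) | ToNext2 => (i + 2, bl)
  end.

Definition weighting (R : realType) (N : nat) := edge -> 'M[R]_N.
Definition gauge (R : realType) (N : nat) := vertex -> 'M[R]_N.

Section Networks.
Context {R : realType} {N : nat}.
Implicit Types (w : weighting R N) (A : gauge R N) (V : lift_seq R N) (n : nat).

Definition alpha w (i : int) := w (i, Left).
Definition beta w (i : int) := w (i, Bottom).
Definition gamma w (i : int) := w (i, Right).

Definition all_weights : set (weighting R N) :=
  [set w | forall i : int,
     [/\ GL N (alpha w i), GL N (beta w i) & GL N (gamma w i)] /\
     [/\ w (i, Top) = 1%:M, w (i, ToNext) = 1%:M & w (i, ToNext2) = 1%:M]].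

Definition translate n w : weighting R N := fun e => w (e.1 + n%:Z, e.2).
Definition periodic_weights n : set (weighting R N) :=
  [set w | all_weights w /\ translate n w = w].

Definition gauge_act A w : weighting R N :=
  fun e => invmx (A (source e)) *m w e *m A (target e).

Definition Gcirc : set (gauge R N) :=
  [set A | (forall v, GL N (A v)) /\
           forall w, all_weights w <-> all_weights (gauge_act A w)].

(* Periodicity is required of the transformation, i.e. of the action on
   weights: it commutes with the translation by n. It holds in particular when
   A itself is n-periodic, but, constant scalars acting trivially, also when
   A (i + n, c) = l *: A (i, c) for a fixed scalar l. The latter are needed to
   reach all twisted lifts of a polygon with monodromy in PGL. *)
Definition Gbullet n : set (gauge R N) :=
  [set A | Gcirc A /\ forall w, all_weights w ->
             gauge_act A (translate n w) = translate n (gauge_act A w)].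
Definition Gbullet_strict n : set (gauge R N) :=
  [set A | Gcirc A /\ forall i c, A (i + n%:Z, c) = A (i, c)].

Definition gauge_orbit (G : set (gauge R N)) w w' : Prop :=
  exists2 A, G A & w' = gauge_act A w.

(* A lift of a twisted n-gon is twisted only up to a change of lift, and its
   weights are periodic only up to gauge. *)
Definition quasi_periodic_weights n : set (weighting R N) :=
  [set w | all_weights w /\
           exists2 w', periodic_weights n w' & gauge_orbit Gcirc w w'].

Definition weights_of V : set (weighting R N) :=
  [set w | all_weights w /\ forall i : int,
     V (i + 3) = V i *m beta w i + V (i + 1) *m alpha w (i + 1)
                 + V (i + 2) *m gamma w i].

(* V_i is attached to the corner bl_i. For A in [Gcirc] one has
   A(bl_(i+2)) = A(tr_i) = A(tl_i) = A(br_(i-1)), so the generator of [Gcirc]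
   attached to the face j multiplies V_(j+2) on the right. *)
Definition change_lift A V : lift_seq R N := fun i => V i *m A (i, bl).

Definition periodic_weights_modG n :=
  quot (periodic_weights n) (gauge_orbit (Gbullet n)).
Definition periodic_weights_cls n :=
  cls (periodic_weights n) (gauge_orbit (Gbullet n)).
Definition periodic_weights_modG_strict n :=
  quot (periodic_weights n) (gauge_orbit (Gbullet_strict n)).
Definition periodic_weights_cls_strict n :=
  cls (periodic_weights n) (gauge_orbit (Gbullet_strict n)).
Definition quasi_periodic_weights_modG n :=
  quot (quasi_periodic_weights n) (gauge_orbit Gcirc).
Definition quasi_periodic_weights_cls n :=
  cls (quasi_periodic_weights n) (gauge_orbit Gcirc).

End Networks.

(* Main.v *)
(** The dependence relations V_{i+3} = V_i beta_i + ... have invertible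
    coefficients, so a lift is recovered from its weights and from the frame
    (V_0 V_1 V_2), in both directions of the index: two lifts have the same
    weights iff they differ by GL_{3N}. Applied to V and its translate by n,
    this makes periodicity of the weights equivalent to V_{i+n} = M V_i, and M
    is determined by V.

    Elements of [Gcirc] are given by arbitrary sequences a_i = A(bl_i) in GL_N
    and act on lifts by V_i |-> V_i a_i, which is the general change of lift of
    a polygon. A lift of a twisted n-gon is made twisted by solving
    V_{i+n} a_{i+n} = M V_i a_i, which splits into n recursions over the
    integers. The transformation given by a is n-periodic iff D_i = a_{i+n} a_i^-1
    satisfies D_i W = W D_{i+2} for all W in GL_N and D_i = D_{i+3}; then D is a
    constant scalar, the factor by which M is rescaled. *)
From mathcomp Require Import all_boot all_order all_algebra.
From mathcomp Require Import boolp classical_sets functions reals.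
From mathcomp Require Import zify.
(* Imported last: MathComp's [nondegenerate] would hide the one of Defs. *)
Require Import Defs.
Set Implicit Arguments.
Unset Strict Implicit.
Unset Printing Implicit Defensive.
Import Order.TTheory GRing.Theory Num.Theory.
Local Open Scope classical_set_scope.
Local Open Scope ring_scope.

(** * Maps out of quotients given as sets of classes *)

Lemma quot_factor (T U : Type) (u0 : U) (A : set T) (e : T -> T -> Prop)
    (f : T -> U) :
  (forall x, A x -> e x x) ->
  (forall x y, A x -> A y -> e x y -> f x = f y) ->
  exists F : set T -> U, forall x, A x -> F (cls A e x) = f x.
Proof.
move=> erefl ef.
(* A class goes to the value of [f] at any representative, every other set to [u0]. Reflexivity puts
   [y] in its own class, so equal classes have related representatives. *)
have /choice[F FE] : forall C, exists u, forall x, A x -> C = cls A e x -> u = f x.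
  move=> C; have [[x Ax ->]|nC] := pselect (exists2 x, A x & C = cls A e x).
    exists (f x) => y Ay xy; have : cls A e x y by rewrite xy; split => //; exact: erefl.
    by move=> [_]; exact: ef.
  by exists u0 => x Ax Cx; case: nC; exists x.
by exists F => x Ax; exact: FE.
Qed.

(** On [A] the relation [e] is the kernel of [f], so it is an equivalence there and classes are
    separated by [f]. *)
Lemma quot_bij (T U : Type) (u0 : U) (A : set T) (B : set U)
    (e : T -> T -> Prop) (f : T -> U) :
  (forall x, A x -> B (f x)) ->
  (forall u, B u -> exists2 x, A x & f x = u) ->
  (forall x y, A x -> A y -> (f x = f y <-> e x y)) ->
  exists F : set T -> U,
    set_bij (quot A e) B F /\ forall x, A x -> F (cls A e x) = f x.
Proof.
move=> fB Bf fe.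
have [||F FE] := @quot_factor T U u0 A e f.
- by move=> x Ax; apply/fe.
- by move=> x y Ax Ay /fe; exact.
exists F; split=> //; split.
- by move=> _ [x Ax <-]; rewrite /= FE //; exact: fB.
- move=> C D; rewrite !inE => -[x Ax <-] [y Ay <-]; rewrite !FE // => fxy.
  by apply/seteqP; split=> z [Az] /fe fz; split=> //; apply/fe => //;
    rewrite -fz // fxy.
- by move=> u /Bf[x Ax <-]; exists (cls A e x); [exists x|exact: FE].
Qed.

(** Since [f] is constant on the classes of [e], it descends to them; since the action respects [e],
    the fibres of the descended map are orbits of whole classes. *)
Lemma quot_quot_bij (R : realType) (N : nat) (T U : Type) (u0 : U) (A : set T)
    (B : set U) (e : T -> T -> Prop) (act : 'M[R]_(N + N + N) -> T -> T)
    (f : T -> U) :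
  (forall x, A x -> e x x) ->
  (forall x y, A x -> A y -> e x y -> f x = f y) ->
  (forall g x, GL _ g -> A x -> A (act g x)) ->
  (forall g x y, e x y -> e (act g x) (act g y)) ->
  (forall g x, GL _ g -> act g (act (invmx g) x) = x) ->
  (forall g x, GL _ g -> act (invmx g) (act g x) = x) ->
  (forall x, A x -> B (f x)) ->
  (forall u, B u -> exists2 x, A x & f x = u) ->
  (forall x y, A x -> A y -> (f x = f y <-> pgl_orbit act x y)) ->
  exists F : set (set T) -> U,
    set_bij (quot (quot A e) (pgl_orbit_cls act)) B F /\
    forall x, A x -> F (cls (quot A e) (pgl_orbit_cls act) (cls A e x)) = f x.
Proof.
move=> erefl ef actA acte actVK actK fB Bf fo.
have [F FE] := quot_factor u0 erefl ef.
have [|||G [Gbij GE]] := @quot_bij _ U u0 (quot A e) B (pgl_orbit_cls act) F.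
- by move=> _ [x Ax <-]; rewrite FE //; exact: fB.
- by move=> u /Bf[x Ax <-]; exists (cls A e x); [exists x|exact: FE].
- move=> _ _ [x Ax <-] [y Ay <-]; rewrite !FE //; split.
    (* The class of [act g x] is the image under [g] of the class of [x]: an element of the former
       is pulled back by [invmx g]. *)
    move=> /fo-/(_ Ax Ay)[g Gg ygx]; exists g => //; apply/seteqP; split=> [z [Az yz]|].
      have Gg' : GL _ (invmx g) by rewrite /GL /= unitmx_inv.
      exists (act (invmx g) z); last exact: actVK.
      split; first exact: actA.
      by rewrite -(actK g x) // -ygx; exact: acte.
    move=> _ [z [Az xz] <-]; split; first exact: actA.
    by rewrite ygx; exact: acte.
  move=> [g Gg yE]; have [] : cls A e y (act g x).
    by rewrite yE; exists x => //; split=> //; exact: erefl.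
  move=> Agx ygx; rewrite (ef _ _ Ay Agx ygx); apply/fo => //.
  by exists g.
by exists G; split=> // x Ax; rewrite GE ?FE //; exists x.
Qed.

(** * Induction and recursion over the integers *)

Lemma int_step_ind (P : int -> Prop) :
  P 0 -> (forall i, P i <-> P (i + 1)) -> forall i, P i.
Proof.
move=> P0 PS; elim=> [//|k Pk|k Pk].
  by have := (PS k%:Z).1 Pk; rewrite -addn1 PoszD.
by apply/PS; rewrite -addn1 PoszD opprD subrK.
Qed.

Lemma int_seq1 (T : Type) (Q : T -> Prop) (r : int -> T -> T -> Prop) (x0 : T) :
  Q x0 ->
  (forall i x, Q x -> exists2 y, Q y & r i x y) ->
  (forall i y, Q y -> exists2 x, Q x & r i x y) ->
  exists a : int -> T, a 0 = x0 /\ forall i, Q (a i) /\ r i (a i) (a (i + 1)).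
Proof.
move=> Q0 up dn.
have /choice[u uP] : forall ix : int * T, exists y, Q ix.2 -> Q y /\ r ix.1 ix.2 y.
  move=> [i x] /=; have [/(up i)[y Qy ry]|nQ] := pselect (Q x); first by exists y.
  by exists x.
have /choice[d dP] : forall ix : int * T, exists y, Q ix.2 -> Q y /\ r ix.1 y ix.2.
  move=> [i x] /=; have [/(dn i)[y Qy ry]|nQ] := pselect (Q x); first by exists y.
  by exists x.
(* [pos k] is the value at k and [neg k] the value at -k. As [Negz k] stands for -(k+1), its value
   is [neg k.+1]; the two halves meet in [x0] at index 0. *)
pose fix pos k := if k is k'.+1 then u (k'%:Z, pos k') else x0.
pose fix neg k := if k is k'.+1 then d (- k'.+1%:Z, neg k') else x0.
have Qpos k : Q (pos k) by elim: k => //= k /(uP (k%:Z, _))[].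
have Qneg k : Q (neg k) by elim: k => //= k /(dP (- k.+1%:Z, _))[].
exists (fun i => match i with Posz k => pos k | Negz k => neg k.+1 end).
split=> // i; split; first by case: i => k; [exact: Qpos|exact: Qneg].
case: i => k.
  by rewrite -PoszD addn1; exact: (uP (k%:Z, pos k) (Qpos k)).2.
have := (dP (- k.+1%:Z, neg k) (Qneg k)).2; rewrite NegzE.
case: k => [//|k]; rewrite (_ : - k.+2%:Z + 1 = Negz k); first exact.
by rewrite NegzE; lia.
Qed.

(** Each residue class modulo [n] is a copy of the integers, on which the relation becomes a
    one-step recursion. *)
Lemma int_seq (n : nat) (T : Type) (Q : T -> Prop) (r : int -> T -> T -> Prop)
    (x0 : T) : (0 < n)%N -> Q x0 ->
  (forall i x, Q x -> exists2 y, Q y & r i x y) ->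
  (forall i y, Q y -> exists2 x, Q x & r i x y) ->
  exists a : int -> T, forall i, Q (a i) /\ r i (a i) (a (i + n%:Z)).
Proof.
move=> n0 Q0 up dn.
have /choice[b bP] : forall m : int, exists a : int -> T,
    forall q, Q (a q) /\ r (q * n%:Z + m) (a q) (a (q + 1)).
  move=> m; have [] := @int_seq1 T Q (fun q => r (q * n%:Z + m)) x0 => //.
  - by move=> i x; exact: up.
  - by move=> i x; exact: dn.
  - by move=> a [_ aP]; exists a.
(* [b m q] is the value at the index q n + m. *)
exists (fun i => b (i %% n%:Z)%Z (i %/ n%:Z)%Z) => i.
have [Qi] := bP (i %% n%:Z)%Z (i %/ n%:Z)%Z; rewrite -divz_eq.
by rewrite modzDr divzDr ?divzz ?dvdzz // eqz_nat -lt0n n0.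
Qed.

(** * Matrices commuting with the general linear group *)

Lemma unitmx_cent_scalar (F : fieldType) (k : nat) (D : 'M[F]_k) :
  (forall W, W \in unitmx -> D *m W = W *m D) -> exists c, D = c%:M.
Proof.
move=> DW; case: k => [|k] in D DW *; first by exists 0; apply/matrixP => -[].
(* The transvection 1 + E_ij is invertible, with inverse 1 - E_ij because E_ij squares to 0.
   Commuting with it means commuting with E_ij. *)
have DE i j : i != j -> D *m delta_mx i j = delta_mx i j *m D.
  move=> ij; have U : 1%:M + delta_mx i j \in (@unitmx F k.+1).
    apply: (proj1 (mulmx1_unit (_ : _ *m (1%:M - delta_mx i j) = _))).
    rewrite mulmxBr mulmx1 mulmxDl mul1mx mul_delta_mx_0 1?eq_sym //.
    by rewrite addr0 addrK.
  by have := DW _ U; rewrite mulmxDr mulmxDl mulmx1 mul1mx => /addrI.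
have Dij i j : i != j -> D j i = 0 /\ D i i = D j j.
  (* [E] compares the entries (x, y) of D E_ij and E_ij D. The entry (j, j) kills the off-diagonal
     term, the entry (i, j) equates two diagonal ones. *)
  move=> ij; have E x y : D x i *+ (y == j) = D j y *+ (x == i).
    have /matrixP/(_ x y) := DE _ _ ij.
    rewrite !mxE (bigD1 i) //= big1 ?addr0; last first.
      by move=> l /negPf li; rewrite !mxE li mulr0.
    rewrite (bigD1 j) //= big1 ?addr0; last first.
      by move=> l /negPf lj; rewrite !mxE lj andbF mul0r.
    rewrite !mxE !eqxx andbT /= mulr_natr => ->.
    by rewrite mulr_natl.
  split; first by have := E j j; rewrite eqxx eq_sym (negPf ij).
  by have := E i j; rewrite !eqxx.
exists (D ord0 ord0); apply/matrixP => i j; rewrite !mxE.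
have [<-|ij] := eqVneq i j; last first.
  by rewrite eq_sym in ij; have [->] := Dij _ _ ij; rewrite mulr0n.
rewrite mulr1n; have [->//|i0] := eqVneq i ord0.
by have [] := Dij _ _ i0.
Qed.

(** * Lifts and the weights of their dependence relations *)

Section Lifts.
Context {R : realType} {N : nat}.
Implicit Types (V : lift_seq R N) (w : weighting R N) (i : int) (n : nat).
Implicit Types (g M : 'M[R]_(N + N + N)).

Definition frame V i := row_mx (row_mx (V i) (V (i + 1))) (V (i + 2)).

Lemma mul_frame V i (X Y Z : 'M[R]_N) :
  frame V i *m col_mx (col_mx X Y) Z =
  V i *m X + V (i + 1) *m Y + V (i + 2) *m Z.
Proof. by rewrite /frame !mul_row_col. Qed.

Lemma frame_inj V i (X Y Z X' Y' Z' : 'M[R]_N) : frame V i \in unitmx ->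
  V i *m X + V (i + 1) *m Y + V (i + 2) *m Z =
  V i *m X' + V (i + 1) *m Y' + V (i + 2) *m Z' ->
  [/\ X = X', Y = Y' & Z = Z'].
Proof.
move=> U; rewrite -!mul_frame => /(can_inj (mulKmx U)).
by move=> /eq_col_mx[/eq_col_mx[-> ->] ->].
Qed.

Lemma frame_actL V i g : frame (actL g V) i = g *m frame V i.
Proof. by rewrite /frame !mul_mx_row. Qed.

(** Invertibility means that only the zero linear form kills all three blocks. In this form it
    passes easily to the next frame and through a change of lift. *)
Lemma frame_unit V i : frame V i \in unitmx <->
  forall u : 'rV_(N + N + N),
    u *m V i = 0 -> u *m V (i + 1) = 0 -> u *m V (i + 2) = 0 -> u = 0.
Proof.
split=> [U u u0 u1 u2|H].
  by apply: (can_inj (mulmxK U)); rewrite mul0mx /frame !mul_mx_row u0 u1 u2 !row_mx0.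
rewrite -row_free_unit; apply: inj_row_free => u.
rewrite /frame !mul_mx_row => /eqP; rewrite !row_mx_eq0 => /andP[/andP[]].
by move=> /eqP u0 /eqP u1 /eqP u2; exact: H.
Qed.

Lemma nondegenerateP V : nondegenerate V -> forall i, frame V i \in unitmx.
Proof. by move=> nV i; have [] := nV i. Qed.

Lemma nondegenerate_inj V i (X Y : 'M[R]_N) : nondegenerate V ->
  V i *m X = V i *m Y -> X = Y.
Proof.
move=> /nondegenerateP/(_ i)/frame_inj H VXY.
by have [] := H X 0 0 Y 0 0 _; rewrite // !mulmx0 VXY.
Qed.

Lemma nondegenerate_rank V i : nondegenerate V -> \rank (V i) = N.
Proof.
move=> /nondegenerateP/(_ i) U; have -> : V i = frame V i *m col_mx (col_mx 1%:M 0) 0.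
  by rewrite mul_frame mulmx1 !mulmx0 !addr0.
rewrite eqmxMfull ?row_full_unit // -mxrank_tr !tr_col_mx tr_scalar_mx !trmx0.
by apply/eqP/row_freeP; exists (col_mx (col_mx 1%:M 0) 0);
  rewrite !mul_row_col !mul0mx mulmx1 !addr0.
Qed.

Lemma lift_weights_exists V : nondegenerate V -> exists w, weights_of V w.
Proof.
move=> nV.
have /choice[c cP] : forall i, exists c : 'M[R]_N * 'M[R]_N * 'M[R]_N,
    [/\ GL N c.1.1, GL N c.1.2, GL N c.2 & V (i + 3) =
        V i *m c.1.1 + V (i + 1) *m c.1.2 + V (i + 2) *m c.2].
  by move=> i; have [_ [B [A [C ?]]]] := nV i; exists (B, A, C).
(* The relation at index i carries [alpha] at i + 1, so the left weight of face i is read from the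
   relation at i - 1. *)
exists (fun e => match e.2 with
  | Left => (c (e.1 - 1)).1.2 | Bottom => (c e.1).1.1 | Right => (c e.1).2
  | _ => 1%:M end).
split=> i; rewrite /alpha /beta /gamma /=.
  by split=> //; have [? _ ? _] := cP i; have [_ ? _ _] := cP (i - 1).
by rewrite addrK; have [] := cP i.
Qed.

Definition lift_weights V : weighting R N :=
  if pselect (exists w, weights_of V w) is left h then projT1 (cid h)
  else fun=> 0.

Lemma lift_weightsP V : nondegenerate V -> weights_of V (lift_weights V).
Proof.
move=> /lift_weights_exists; rewrite /lift_weights.
by case: pselect => // h _; case: cid.
Qed.

Lemma eq_weights w w' : all_weights w -> all_weights w' ->
  (forall i, [/\ alpha w i = alpha w' i, beta w i = beta w' i &
                 gamma w i = gamma w' i]) -> w = w'.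
Proof.
move=> aw aw' E; apply/funext => -[i a].
have [_ [t1 t2 t3]] := aw i; have [_ [t1' t2' t3']] := aw' i; have [? ? ?] := E i.
by case: a => //; congruence.
Qed.

Lemma weights_of_inj V w w' : nondegenerate V ->
  weights_of V w -> weights_of V w' -> w = w'.
Proof.
move=> nV [aw wV] [aw' wV']; apply: eq_weights => // i.
have E j := frame_inj (nondegenerateP nV j) (etrans (esym (wV j)) (wV' j)).
have [eb _ eg] := E i; have [_ + _] := E (i - 1).
by rewrite subrK.
Qed.

Lemma lift_weightsE V w : nondegenerate V -> weights_of V w ->
  lift_weights V = w.
Proof. by move=> nV; apply: weights_of_inj => //; exact: lift_weightsP. Qed.

(** A form killing V_(i+1) and V_(i+2) kills V_(i+3) iff it kills V_i, because [beta w i] is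
    invertible. Hence one invertible frame makes all frames invertible. *)
Lemma weights_of_lift V w : frame V 0 \in unitmx -> weights_of V w ->
  nondegenerate V.
Proof.
move=> U [aw wV]; suff Ui i : frame V i \in unitmx.
  move=> i; split; first exact: Ui.
  exists (beta w i), (alpha w (i + 1)), (gamma w i).
  by have [[? ? ?] _] := aw i; have [[? ? ?] _] := aw (i + 1).
elim/int_step_ind: i => // i; have [[_ ub _] _] := aw i.
rewrite !frame_unit -!addrA; split=> H u.
  move=> u1 u2 u3; apply: H => //; apply: (can_inj (mulmxK ub)).
  move: u3; rewrite wV !mulmxDr !mulmxA u1 u2 !mul0mx !addr0.
  by [].
move=> u0 u1 u2; apply: H => //.
by rewrite wV !mulmxDr !mulmxA u0 u1 u2 !mul0mx !addr0.
Qed.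

Lemma exists_lift w : all_weights w -> exists2 V, nondegenerate V & weights_of V w.
Proof.
move=> aw; pose X := 'M[R]_(N + N + N, N); pose T := (X * X * X)%type.
pose I : 'M[R]_(N + N + N) := 1%:M.
(* The recursion runs on triples (V_i, V_(i+1), V_(i+2)) and starts from the three blocks of the
   identity matrix. *)
pose r i (s t : T) := [/\ t.1.1 = s.1.2, t.1.2 = s.2 &
  t.2 = s.1.1 *m beta w i + s.1.2 *m alpha w (i + 1) + s.2 *m gamma w i].
have [||s [s0 sP]] := @int_seq1 T (fun=> True) r
  (lsubmx (lsubmx I), rsubmx (lsubmx I), rsubmx I) Logic.I.
- by move=> i [[x y] z] _; eexists (_, _, _).
- move=> i [[y z] t] _; have [[_ ub _] _] := aw i.
  (* The backward step solves the relation for V_i. *)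
  exists ((t - y *m alpha w (i + 1) - z *m gamma w i) *m invmx (beta w i), y, z) => //.
  split=> //=; rewrite mulmxKV //.
  by rewrite [_ - _ - _ + _]addrAC !subrK.
pose V i := (s i).1.1.
have V1 i : V (i + 1) = (s i).1.2 by rewrite /V; have [_ [-> _ _]] := sP i.
have V2 i : V (i + 2) = (s i).2.
  by rewrite -[2]/(1 + 1) addrA V1; have [_ [_ -> _]] := sP i.
have wV : weights_of V w.
  split=> // i; rewrite -[3]/(1 + 2) addrA V2 V1 V2.
  by have [_ [_ _ ->]] := sP i.
exists V => //; apply: weights_of_lift wV.
by rewrite /frame V1 V2 /V s0 /= !hsubmxK unitmx1.
Qed.

Lemma weights_of_actL V w g : weights_of V w -> weights_of (actL g V) w.
Proof. by move=> [aw wV]; split=> // i; rewrite /actL wV !mulmxDr !mulmxA. Qed.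

Lemma nondegenerate_actL V g : GL _ g -> nondegenerate V ->
  nondegenerate (actL g V).
Proof.
move=> Gg nV; apply: (weights_of_lift (w := lift_weights V)).
  by rewrite frame_actL unitmx_mul Gg nondegenerateP.
exact/weights_of_actL/lift_weightsP.
Qed.

Lemma lift_weights_actL V g : GL _ g -> nondegenerate V ->
  lift_weights (actL g V) = lift_weights V.
Proof.
move=> Gg nV; apply: lift_weightsE; first exact: nondegenerate_actL.
exact/weights_of_actL/lift_weightsP.
Qed.

Lemma eq_lift V V' w : weights_of V w -> weights_of V' w ->
  V 0 = V' 0 -> V 1 = V' 1 -> V 2 = V' 2 -> V = V'.
Proof.
move=> [aw wV] [_ wV'] e0 e1 e2; apply/funext => i.
suff [] : [/\ V i = V' i, V (i + 1) = V' (i + 1) & V (i + 2) = V' (i + 2)] by [].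
elim/int_step_ind: i => // i; have [[_ ub _] _] := aw i.
rewrite -!addrA; split=> [[f0 f1 f2]|[f1 f2 f3]]; split=> //.
  by rewrite wV wV' f0 f1 f2.
apply: (can_inj (mulmxK ub)); move: f3.
by rewrite wV wV' f1 f2 => /addIr/addIr.
Qed.

Lemma same_weights V V' w : nondegenerate V -> nondegenerate V' ->
  weights_of V w -> weights_of V' w -> exists2 g, GL _ g & V' = actL g V.
Proof.
move=> nV nV' wV wV'; have [U U'] := (nondegenerateP nV 0, nondegenerateP nV' 0).
(* The only matrix carrying the frame of [V] at 0 to that of [V']; the common recursion does the
   rest. *)
pose g := frame V' 0 *m invmx (frame V 0).
have : frame V' 0 = frame (actL g V) 0 by rewrite frame_actL mulmxKV.
move=> /eq_row_mx[/eq_row_mx[e0 e1] e2].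
exists g; first by rewrite /GL /= unitmx_mul U' unitmx_inv.
exact: eq_lift wV' (weights_of_actL g wV) e0 e1 e2.
Qed.

Lemma lift_weights_eq V V' : nondegenerate V -> nondegenerate V' ->
  (lift_weights V = lift_weights V' <-> exists2 g, GL _ g & V' = actL g V).
Proof.
move=> nV nV'; split=> [E|[g Gg ->]]; last by rewrite lift_weights_actL.
apply: (same_weights nV nV' (lift_weightsP nV)).
by rewrite E; exact: lift_weightsP.
Qed.

Lemma lift_mull_inj V g g' : nondegenerate V ->
  (forall i, g *m V i = g' *m V i) -> g = g'.
Proof.
move=> /nondegenerateP/(_ 0) U E; apply: (can_inj (mulmxK U)).
by rewrite /frame !mul_mx_row !E.
Qed.

Lemma translate_weights n V w : nondegenerate V -> weights_of V w ->
  (translate n w = w <->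
   exists2 M, GL _ M & forall i, V (i + n%:Z) = M *m V i).
Proof.
move=> nV wV; pose V' i := V (i + n%:Z).
have wV' : weights_of V' (translate n w).
  have [aw E] := wV; split=> [i|i]; first exact: aw.
  rewrite /V' (addrAC i 3) (addrAC i 1) (addrAC i 2) E.
  by rewrite /alpha /translate /= (addrAC i 1).
have nV' : nondegenerate V'.
  apply: weights_of_lift wV'; rewrite /frame /V' (addrAC 0 1) (addrAC 0 2).
  exact: nondegenerateP.
split=> [E|[M GM E]].
  have [|M GM VM] := same_weights nV nV' wV _; first by rewrite -E.
  by exists M => // i; rewrite -[LHS]/(V' i) VM.
apply: (weights_of_inj nV') wV' _.
by rewrite (_ : V' = actL M V); [exact: weights_of_actL|exact/funext].
Qed.

End Lifts.

(** * Gauge transformations preserving the identity weights *)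

Section Gauge.
Context {R : realType} {N : nat}.
Implicit Types (V : lift_seq R N) (w : weighting R N) (i : int) (n : nat).
Implicit Types (a : int -> 'M[R]_N) (A : gauge R N).

Lemma invmx_conj1 k (X W : 'M[R]_k) : X \in unitmx ->
  (invmx X *m W *m X = 1%:M <-> W = 1%:M).
Proof.
move=> UX; split=> [E|->]; last by rewrite mulmx1 mulVmx.
apply: (can_inj (mulKmx (etrans (unitmx_inv _) UX))); apply: (can_inj (mulmxK UX)).
by rewrite E mulmx1 mulVmx.
Qed.

(** For X = a_i, Z = a_(i+n), Y = a_(i+s), T = a_(i+n+s), with s the index shift along an edge, this
    is the intertwining relation D_i W = W D_(i+s). *)
Lemma invmx_conj_eq k (X Y Z T W : 'M[R]_k) : X \in unitmx -> Y \in unitmx ->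
  Z \in unitmx -> invmx X *m W *m Y = invmx Z *m W *m T ->
  (Z *m invmx X) *m W = W *m (T *m invmx Y).
Proof.
move=> UX UY UZ E; apply: (can_inj (mulmxK UY)).
rewrite -!mulmxA mulVmx // mulmx1 (mulmxA (invmx X)) E !mulmxA mulmxV //.
by rewrite mul1mx.
Qed.

(** An edge that keeps weight 1 forces equal gauge values at its two ends. This links tl_i and tr_i
    to bl_(i+2), and br_i through tl_(i+1) to bl_(i+3), leaving one free matrix per index. *)
Definition gauge_of a : gauge R N := fun v =>
  match v.2 with bl => a v.1 | tl | tr => a (v.1 + 2) | br => a (v.1 + 3) end.

Lemma Gcirc_gauge_of a : (forall i, GL N (a i)) -> Gcirc (gauge_of a).
Proof.
move=> Ga; have Gv v : gauge_of a v \in unitmx by case: v => i [] /=; exact: Ga.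
split=> // w.
have Ge e : gauge_act (gauge_of a) w e \in unitmx = (w e \in unitmx).
  by rewrite /gauge_act !unitmx_mul unitmx_inv !Gv andbT.
have Gt i : gauge_act (gauge_of a) w (i, Top) = 1%:M <-> w (i, Top) = 1%:M.
  exact: invmx_conj1.
have Gn i : gauge_act (gauge_of a) w (i, ToNext) = 1%:M <-> w (i, ToNext) = 1%:M.
  rewrite /gauge_act (_ : gauge_of a (target (i, ToNext)) =
    gauge_of a (source (i, ToNext))).
    exact: invmx_conj1.
  by rewrite /gauge_of /= -addrA.
have Gm i : gauge_act (gauge_of a) w (i, ToNext2) = 1%:M <-> w (i, ToNext2) = 1%:M.
  exact: invmx_conj1.
split=> aw i; have [[]] := aw i; rewrite /alpha /beta /gamma /GL /= ?Ge.
  by move=> ? ? ? [/Gt ? /Gn ? /Gm ?].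
by move=> ? ? ? [/Gt ? /Gn ? /Gm ?].
Qed.

Lemma GcircP A : Gcirc A ->
  (forall i, GL N (A (i, bl))) /\ A = gauge_of (fun i => A (i, bl)).
Proof.
move=> [GA AP]; split=> //.
(* The all-identity weighting is a test case: each edge that must keep weight 1 yields an equality
   of two values of [A]. *)
have w1 : all_weights (fun=> 1%:M : 'M[R]_N).
  by move=> i; rewrite /alpha /beta /gamma /GL /= unitmx1.
have a1 := (AP _).1 w1.
have H e : gauge_act A (fun=> 1%:M) e = 1%:M -> A (target e) = A (source e).
  rewrite /gauge_act mulmx1 => E.
  apply: (can_inj (mulKmx (etrans (unitmx_inv _) (GA (source e))))).
  by rewrite E mulVmx //; exact: GA.
have Htr i : A (i, tr) = A (i + 2, bl).
  by have [_ [_ _ /H]] := a1 i.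
have Htl i : A (i, tl) = A (i + 2, bl).
  by rewrite -Htr; have [_ [/H]] := a1 i.
apply/funext => -[i []] //=.
by have [_ [_ /H /= <- _]] := a1 i; rewrite Htl -addrA.
Qed.

(** In each term of the new relation the factor a of the lift cancels the inverse factor at the
    source of the edge. All three edges end in a_(i+3), so the relation is just multiplied by it on
    the right. *)
Lemma weights_of_change a V w : (forall i, GL N (a i)) -> weights_of V w ->
  weights_of (change_lift (gauge_of a) V) (gauge_act (gauge_of a) w).
Proof.
move=> Ga [aw wV]; have [_ /(_ w)[GA _]] := Gcirc_gauge_of Ga.
split; first exact: GA.
move=> i; rewrite /change_lift /alpha /beta /gamma /gauge_act /gauge_of /=.
rewrite !mulmxA !mulmxK; try exact: Ga.
by rewrite wV !mulmxDl -!addrA.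
Qed.

Lemma nondegenerate_change a V : (forall i, GL N (a i)) -> nondegenerate V ->
  nondegenerate (change_lift (gauge_of a) V).
Proof.
move=> Ga nV; apply: weights_of_lift (weights_of_change Ga (lift_weightsP nV)).
apply/frame_unit => u; rewrite /change_lift /gauge_of /= !mulmxA.
have V0 i : u *m V i *m a i = 0 -> u *m V i = 0.
  by move=> E; apply: (can_inj (mulmxK (Ga i))); rewrite E mul0mx.
move=> /V0 u0 /V0 u1 /V0 u2; move: u u0 u1 u2 {V0}.
exact/frame_unit/nondegenerateP.
Qed.

Lemma lift_weights_change A V : Gcirc A -> nondegenerate V ->
  lift_weights (change_lift A V) = gauge_act A (lift_weights V).
Proof.
move=> /GcircP[Ga ->] nV; apply: lift_weightsE; first exact: nondegenerate_change.
exact/weights_of_change/lift_weightsP.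
Qed.

Lemma Gbullet_gauge_of n a : (0 < N)%N -> (forall i, GL N (a i)) ->
  (Gbullet n (gauge_of a) <->
   exists2 c, c != 0 & forall i, a (i + n%:Z) = c *: a i).
Proof.
move=> N0 Ga; split=> [[_ H]|[c c0 E]]; last first.
  split; first exact: Gcirc_gauge_of.
  have Ev v : gauge_of a (v.1 + n%:Z, v.2) = c *: gauge_of a v.
    by case: v => i [] /=; rewrite /gauge_of /= ?E // addrAC E.
  have Gv v : gauge_of a v \in unitmx by case: v => i [] /=; exact: Ga.
  move=> w aw; apply/funext => -[i e]; rewrite /translate /gauge_act.
  have -> : source (i + n%:Z, e) = ((source (i, e)).1 + n%:Z, (source (i, e)).2).
    by case: e.
  have -> : target (i + n%:Z, e) = ((target (i, e)).1 + n%:Z, (target (i, e)).2).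
    by case: e => //=; rewrite addrAC.
  (* The scalar enters inverted at the source and directly at the target, so it cancels. *)
  rewrite !Ev invmxZ ?unitmxZ ?unitfE // -!scalemxAl -scalemxAr scalerA.
  by rewrite mulVf // scale1r.
pose D i := a (i + n%:Z) *m invmx (a i).
(* Test weightings with an arbitrary invertible [W] on the left edges. The left edge shifts the
   index by 2, the bottom edge by 3. *)
pose w W : weighting R N := fun e => if e.2 is Left then W else 1%:M.
have wP W : W \in unitmx -> all_weights (w W).
  by move=> UW i; rewrite /alpha /beta /gamma /GL /= unitmx1.
have DW W i : W \in unitmx -> D i *m W = W *m D (i + 2).
  move=> UW; have /(congr1 (fun f => f (i, Left))) := H _ (wP _ UW).
  rewrite /translate /gauge_act /gauge_of /= /D (addrAC i 2).
  by apply: invmx_conj_eq; exact: Ga.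
have D3 i : D i = D (i + 3).
  have /(congr1 (fun f => f (i, Bottom))) := H _ (wP _ (unitmx1 _ _)).
  rewrite /translate /gauge_act /gauge_of /= /D (addrAC i 3).
  by move=> /invmx_conj_eq; rewrite mulmx1 mul1mx; apply; exact: Ga.
have D2 i : D i = D (i + 2).
  by have := DW _ i (unitmx1 _ _); rewrite mulmx1 mul1mx.
(* Periods 2 and 3 together give period 1. *)
have D1 i : D i = D (i + 1) by rewrite D3 (D2 (i + 1)) -addrA.
have D0 i : D i = D 0 by elim/int_step_ind: i => // i; rewrite -D1.
have [|c Dc] := @unitmx_cent_scalar _ _ (D 0).
  by move=> W UW; rewrite (DW _ _ UW) -D2.
have UD : D 0 \in unitmx by rewrite unitmx_mul unitmx_inv (Ga 0) (Ga (0 + n%:Z)).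
exists c.
  (* As N > 0, the zero scalar matrix has determinant 0. *)
  apply: contraTneq UD => c0; rewrite Dc c0 unitmxE det_scalar expr0n.
  by rewrite gtn_eqF // unitr0.
move=> i; have := D0 i; rewrite Dc /D => E.
by rewrite -(mulmxKV (Ga i) (a (i + n%:Z))) E mul_scalar_mx.
Qed.

Lemma Gbullet_strict_gauge_of n a : (forall i, GL N (a i)) ->
  (Gbullet_strict n (gauge_of a) <-> forall i, a (i + n%:Z) = a i).
Proof.
move=> Ga; split=> [[_ E] i|E]; first exact: (E i bl).
split; first exact: Gcirc_gauge_of.
by move=> i []; rewrite /gauge_of /= ?E // addrAC E.
Qed.

End Gauge.

(** * Polygons, their monodromies and their twisted lifts *)

Section Polygons.
Context {R : realType} {N : nat}.
Implicit Types (V : lift_seq R N) (w : weighting R N) (i : int) (n : nat).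
Implicit Types (a : int -> 'M[R]_N) (A : gauge R N) (p : polygon R N).
Implicit Types (g M : 'M[R]_(N + N + N)) (m : set 'M[R]_(N + N + N)).
Implicit Types (P : polygon R N * set 'M[R]_(N + N + N)).
Implicit Types (VM : lift_seq R N * 'M[R]_(N + N + N)).

Definition polygon_of V : polygon R N :=
  fun i => [set A | exists2 X : 'M[R]_N, GL N X & A = V i *m X].

Definition pgl_class M : set 'M[R]_(N + N + N) :=
  cls (GL (N + N + N)) (@proportional R (N + N + N)) M.

Lemma Gr_polygon_of V i : \rank (V i) = N -> Gr (polygon_of V i).
Proof.
move=> rV; exists (V i) => //; apply/seteqP; split=> B; first by case.
move=> [X GX ->]; split; last by exists X.
by rewrite /= mxrankMfree // row_free_unit.
Qed.

Lemma lift_of_polygon_of V : lift_of (polygon_of V) V.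
Proof. by move=> i; exists 1%:M; rewrite ?mulmx1 // /GL /= unitmx1. Qed.

Lemma lift_ofE p V : (forall i, Gr (p i)) -> lift_of p V -> p = polygon_of V.
Proof.
move=> Gp pV; apply/funext => i; have [A rA pA] := Gp i.
have := pV i; rewrite -pA => -[_ [X GX VX]]; apply/seteqP; split=> B.
  move=> [_ [Y GY ->]]; exists (invmx X *m Y).
    by rewrite /GL /= unitmx_mul unitmx_inv GX.
  by rewrite VX mulmxA mulmxK.
move=> [Y GY ->]; have GXY : GL N (X *m Y) by rewrite /GL /= unitmx_mul GX.
split; last by exists (X *m Y); rewrite // VX mulmxA.
by rewrite /= VX -mulmxA mxrankMfree // row_free_unit.
Qed.

Lemma lift_of_changeP V V' : lift_of (polygon_of V) V' <->
  exists2 a, (forall i, GL N (a i)) & V' = change_lift (gauge_of a) V.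
Proof.
split=> [VV'|[a Ga ->] i]; last by exists (a i).
have /choice[a aP] : forall i, exists X, GL N X /\ V' i = V i *m X.
  by move=> i; have [X ? ?] := VV' i; exists X.
exists a => [i|]; first by have [] := aP i.
by apply/funext => i; have [] := aP i.
Qed.

Lemma pgl_class_refl M : GL _ M -> pgl_class M M.
Proof. by move=> GM; split=> //; exists 1; rewrite ?oner_eq0 ?scale1r. Qed.

Lemma PGL_pgl_class M : GL _ M -> PGL (N + N + N) (pgl_class M).
Proof. by exists M. Qed.

Lemma PGL_rep m M : PGL (N + N + N) m -> m M -> GL _ M /\ m = pgl_class M.
Proof.
move=> [M0 GM0 <-] [GM [c c0 MM0]]; split=> //; apply/seteqP.
split=> M' [GM' [d d0 M'E]]; split=> //.
  exists (d / c); first by rewrite mulf_neq0 ?invr_eq0.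
  by rewrite MM0 scalerA divfK.
by exists (d * c); rewrite ?mulf_neq0 // M'E MM0 scalerA.
Qed.

(** Testing a single representative suffices: another one is [c *: M], and the scalar is absorbed
    into the change of basis [X]. *)
Lemma is_monodromyP n V M : GL _ M ->
  (is_monodromy n (polygon_of V) (pgl_class M) <->
   forall i, exists2 X, GL N X & V (i + n%:Z) *m X = M *m V i).
Proof.
move=> GM; split=> [[_ /(_ _ (pgl_class_refl GM)) E] i|E].
  have : (mulmx M @` polygon_of V i) (M *m V i).
    by exists (V i) => //; exact: lift_of_polygon_of.
  by rewrite -E => -[X GX ->]; exists X.
split; first exact: PGL_pgl_class.
move=> _ [_ [c c0 ->]] i; have [X GX EX] := E i.
apply/seteqP; split=> [_ [Y GY ->]|_ [_ [Y GY ->] <-]].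
  exists (V i *m (c^-1 *: (invmx X *m Y))).
    exists (c^-1 *: (invmx X *m Y)) => //.
    by rewrite /GL /= unitmxZ ?unitfE ?invr_eq0 // unitmx_mul unitmx_inv GX.
  rewrite -!scalemxAr -scalemxAl scalerA mulVf // scale1r mulmxA -EX.
  by rewrite mulmxA mulmxK.
exists (c *: (X *m Y)).
  by rewrite /GL /= unitmxZ ?unitfE // unitmx_mul GX.
by rewrite mulmxA -scalemxAl -EX -scalemxAr -scalemxAl mulmxA.
Qed.

(** Nondegeneracy survives every change of lift, so one nondegenerate lift accounts for all of
    them. *)
Lemma twisted_polygon_of n V m : nondegenerate V ->
  is_monodromy n (polygon_of V) m -> twisted_ngon n (polygon_of V).
Proof.
move=> nV mV; split.
- by move=> i; apply/Gr_polygon_of/nondegenerate_rank.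
- by exists m.
- by move=> V' /lift_of_changeP[a Ga ->]; exact: nondegenerate_change.
Qed.

Lemma twisted_ngon_lift n p V : twisted_ngon n p -> lift_of p V ->
  nondegenerate V /\ p = polygon_of V.
Proof. by move=> [Gp _ nV] pV; split; [exact: nV|exact: lift_ofE]. Qed.

Lemma twisted_ngon_has_lift n p : twisted_ngon n p -> exists V, lift_of p V.
Proof.
move=> [Gp _ _]; have /choice[V VP] : forall i, exists B, p i B.
  move=> i; have [B rB <-] := Gp i; exists B; split=> //.
  by exists 1%:M; rewrite ?mulmx1 // /GL /= unitmx1.
by exists V.
Qed.

Lemma twisted_liftsP n VM : twisted_lifts n VM <->
  [/\ nondegenerate VM.1, GL _ VM.2 & forall i, VM.1 (i + n%:Z) = VM.2 *m VM.1 i].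
Proof.
case: VM => V M; split=> -[/= lV GM E]; split=> //.
  by have [p tp pV] := lV; have [] := twisted_ngon_lift tp pV.
exists (polygon_of V); last exact: lift_of_polygon_of.
apply: (@twisted_polygon_of _ _ (pgl_class M)) => //.
apply/is_monodromyP => // i; exists 1%:M; first by rewrite /GL /= unitmx1.
by rewrite mulmx1.
Qed.

Lemma twisted_lift_ofP n P VM : marked_ngon n P ->
  (twisted_lift_of n P VM <->
   twisted_lifts n VM /\ P = (polygon_of VM.1, pgl_class VM.2)).
Proof.
case: P VM => p m [V M] [/= tp [Pm _]]; split=> [[/= tV pV mM]|[tV [-> ->]]].
  split=> //; have [_ ->] := twisted_ngon_lift tp pV.
  by have [_ ->] := PGL_rep Pm mM.
split=> //=; first exact: lift_of_polygon_of.
by apply: pgl_class_refl; have [] := tV.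
Qed.

Lemma twisted_lift_marked n VM : twisted_lifts n VM ->
  marked_ngon n (polygon_of VM.1, pgl_class VM.2) /\
  twisted_lift_of n (polygon_of VM.1, pgl_class VM.2) VM.
Proof.
move=> tV; suff mP : marked_ngon n (polygon_of VM.1, pgl_class VM.2).
  by split=> //; exact/twisted_lift_ofP.
have [nV GM E] := (twisted_liftsP n VM).1 tV.
suff mV : is_monodromy n (polygon_of VM.1) (pgl_class VM.2).
  by split=> //; exact: twisted_polygon_of mV.
apply/is_monodromyP => // i; exists 1%:M; first by rewrite /GL /= unitmx1.
by rewrite mulmx1.
Qed.

Lemma marked_ngon_twist n P V M : (0 < n)%N -> marked_ngon n P ->
  lift_of P.1 V -> P.2 M ->
  exists2 A, Gcirc A & twisted_lift_of n P (change_lift A V, M).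
Proof.
case: P => p m n0 mP pV mM; have [/= tp Pm] := mP.
have [nV pE] := twisted_ngon_lift tp pV; have [GM mE] := PGL_rep Pm.1 mM.
move: Pm; rewrite pE mE => /is_monodromyP-/(_ GM) VX.
(* With V_(i+n) X = M V_i and X invertible, the recursion reads y = X x, solvable in both
   directions. *)
have [|||a aP] := @int_seq n _ (GL N)
  (fun i x y => V (i + n%:Z) *m y = M *m (V i *m x)) 1%:M n0.
- by rewrite /GL /= unitmx1.
- move=> i x Gx; have [X GX E] := VX i; exists (X *m x).
    by rewrite /GL /= unitmx_mul GX.
  by rewrite !mulmxA E.
- move=> i y Gy; have [X GX E] := VX i; exists (invmx X *m y).
    by rewrite /GL /= unitmx_mul unitmx_inv GX.
  by rewrite !mulmxA -E mulmxK.
have Ga i : GL N (a i) by have [] := aP i.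
exists (gauge_of a); first exact: Gcirc_gauge_of.
split=> //=; last exact: pgl_class_refl.
  apply/twisted_liftsP; split=> //=; first exact: nondegenerate_change.
  by move=> i; have [] := aP i.
by apply/lift_of_changeP; exists a.
Qed.

Lemma marked_ngon_has_lift n P : (0 < n)%N -> marked_ngon n P ->
  exists VM, twisted_lift_of n P VM.
Proof.
move=> n0 mP; have [tp [[M GM mM] _]] := mP.
have [V pV] := twisted_ngon_has_lift tp.
have [|A _ ?] := marked_ngon_twist (M := M) n0 mP pV; last by exists (change_lift A V, M).
by rewrite -mM; exact: pgl_class_refl.
Qed.

Lemma twisted_lift_weights n VM : twisted_lifts n VM ->
  periodic_weights n (lift_weights VM.1).
Proof.
move=> /twisted_liftsP[nV GM E]; have wV := lift_weightsP nV.
by split; [case: wV|apply/(translate_weights n nV wV); exists VM.2].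
Qed.

Lemma periodic_weights_lift n w : periodic_weights n w ->
  exists2 VM, twisted_lifts n VM & lift_weights VM.1 = w.
Proof.
move=> [aw tw]; have [V nV wV] := exists_lift aw.
have [M GM E] := (translate_weights n nV wV).1 tw.
by exists (V, M); [exact/twisted_liftsP|exact: lift_weightsE].
Qed.

Lemma twisted_lifts_eq n VM VM' : twisted_lifts n VM -> twisted_lifts n VM' ->
  (lift_weights VM.1 = lift_weights VM'.1 <-> pgl_orbit actTL VM VM').
Proof.
case: VM VM' => V M [V' M'] /twisted_liftsP[/= nV GM E] /twisted_liftsP[/= nV' GM' E'].
rewrite lift_weights_eq //; split=> [[g Gg VV']|[g Gg [-> _]]]; last by exists g.
exists g => //; rewrite VV'; congr (_, _).
apply: (can_inj (mulmxK Gg)); rewrite mulmxKV //.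
(* Both [M' *m g] and [g *m M] send V_i to g V_(i+n). *)
apply: (lift_mull_inj nV) => i; rewrite -!mulmxA -E.
by have := E' i; rewrite VV' /actL.
Qed.

(** One direction twists the lift, making its weights periodic. In the other, periodic weights in
    the gauge orbit provide a twisted lift, hence a polygon, of which [V] is another lift. *)
Lemma liftsP n V : (0 < n)%N -> (lifts n V <->
  nondegenerate V /\ quasi_periodic_weights n (lift_weights V)).
Proof.
move=> n0; split=> [[p tp pV]|[nV [_ [w' pw' [A GA w'E]]]]].
  have [nV _] := twisted_ngon_lift tp pV; split=> //.
  split; first by case: (lift_weightsP nV).
  have [_ [m Pm] _] := tp; have [M GM mM] := Pm.1.
  have mM' : m M by rewrite -mM; exact: pgl_class_refl.
  have [//|A GA [tV _ _]] := marked_ngon_twist (P := (p, m)) n0 _ pV mM'.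
  exists (lift_weights (change_lift A V)); first exact: (twisted_lift_weights tV).
  by exists A => //; exact: lift_weights_change.
have [Ga AE] := GcircP GA.
have nV' : nondegenerate (change_lift A V) by rewrite AE; exact: nondegenerate_change.
have wV' : weights_of (change_lift A V) w'.
  by rewrite w'E -lift_weights_change //; exact: lift_weightsP.
have [M GM E] := (translate_weights n nV' wV').1 pw'.2.
have /twisted_lift_marked[[/= tp _] _] : twisted_lifts n (change_lift A V, M).
  exact/twisted_liftsP.
exists (polygon_of (change_lift A V)) => // i.
(* Undoes the change of lift at index i. *)
exists (invmx (A (i, bl))); first by rewrite /GL /= unitmx_inv; exact: Ga.
by rewrite /change_lift mulmxK //; exact: Ga.
Qed.

End Polygons.

(** * Group actions and changes of lift of a fixed polygon *)

Section Correspondence.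
Context {R : realType} {N n : nat}.
Context (hN : (0 < N)%N) (hn : (0 < n)%N).
Implicit Types (V : lift_seq R N) (w : weighting R N) (i : int).
Implicit Types (A : gauge R N) (p : polygon R N).
Implicit Types (g M : 'M[R]_(N + N + N)) (m : set 'M[R]_(N + N + N)).
Implicit Types (P : polygon R N * set 'M[R]_(N + N + N)).
Implicit Types (VM : lift_seq R N * 'M[R]_(N + N + N)).

Lemma actTLK g VM : GL _ g -> actTL (invmx g) (actTL g VM) = VM.
Proof.
case: VM => V M Gg; congr (_, _); first by apply/funext => i; rewrite /actL /= mulKmx.
by rewrite /= invmxK -!mulmxA mulVmx // mulmx1 !mulmxA mulVmx // mul1mx.
Qed.

Lemma actLK g V : GL _ g -> actL (invmx g) (actL g V) = V.
Proof. by move=> Gg; apply/funext => i; rewrite /actL mulKmx. Qed.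

Lemma actMP_polygon_of g V M : GL _ g -> GL _ M ->
  actMP g (polygon_of V, pgl_class M) =
  (polygon_of (actL g V), pgl_class (g *m M *m invmx g)).
Proof.
move=> Gg GM; congr (_, _).
  apply/funext => i; apply/seteqP; split=> [_ [_ [X GX ->] <-]|_ [X GX ->]].
    by exists X => //; rewrite mulmxA.
  by exists (V i *m X); [exists X|rewrite /actL mulmxA].
apply/seteqP; split=> [_ [_ [_ [c c0 ->]] <-]|_ [_ [c c0 ->]]].
  split; last by exists c; rewrite // -scalemxAr -scalemxAl.
  by rewrite /GL /= !unitmx_mul unitmx_inv Gg unitmxZ ?unitfE // GM.
exists (c *: M); last by rewrite /= -scalemxAr -scalemxAl.
by split; [rewrite /GL /= unitmxZ ?unitfE|exists c].
Qed.

Lemma actP_polygon_of g V : GL _ g ->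
  actP g (polygon_of V) = polygon_of (actL g V).
Proof.
(* First component of the marked case, taken with the matrix 1. *)
move=> Gg; have G1 : GL (N + N + N) (1%:M : 'M[R]_(N + N + N)) by exact: unitmx1.
by have /(congr1 fst) := actMP_polygon_of V Gg G1.
Qed.

Lemma twisted_lifts_actTL g VM : GL _ g -> twisted_lifts n VM ->
  twisted_lifts n (actTL g VM).
Proof.
move=> Gg /twisted_liftsP[nV GM E]; apply/twisted_liftsP; split=> /=.
- exact: nondegenerate_actL.
- by rewrite /GL /= !unitmx_mul unitmx_inv Gg GM.
- by move=> i; rewrite /actL E !mulmxA mulmxKV.
Qed.

Lemma lifts_nondegenerate V : lifts n V -> nondegenerate V.
Proof. by move=> /liftsP[]. Qed.

(** A dilation is the action of a scalar matrix, so it leaves the weights unchanged. *)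
Lemma dilation_actL V V' : dilation V V' -> exists2 g, GL _ g & V' = actL g V.
Proof.
move=> [c c0 ->]; exists c%:M.
  by rewrite /GL /= unitmxE det_scalar unitrX // unitfE.
by apply/funext => i; rewrite /actL mul_scalar_mx.
Qed.

Lemma dilation_refl V : dilation V V.
Proof. by exists 1; rewrite ?oner_eq0 //; apply/funext => i; rewrite scale1r. Qed.

Lemma actL_dilation g V V' : dilation V V' -> dilation (actL g V) (actL g V').
Proof.
by move=> [c c0 ->]; exists c => //; apply/funext => i; rewrite /actL scalemxAr.
Qed.

Lemma lift_of_GcircP p V V' : twisted_ngon n p -> lift_of p V ->
  (lift_of p V' <-> exists2 A, Gcirc A & V' = change_lift A V).
Proof.
move=> tp /(twisted_ngon_lift tp)[_ ->]; rewrite lift_of_changeP; split.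
  by move=> [a Ga ->]; exists (gauge_of a) => //; exact: Gcirc_gauge_of.
by move=> [A /GcircP[Ga ->] ->]; exists (fun i => A (i, bl)).
Qed.

(** Matrices representing the same monodromy are M and c M. Cancelling V_(i+n) in the twist relation
    of the changed lift gives a_(i+n) = c a_i, which characterizes [Gbullet]. *)
Lemma twisted_lift_of_GbulletP P VM V' : marked_ngon n P ->
  twisted_lift_of n P VM ->
  ((exists M', twisted_lift_of n P (V', M')) <->
   exists2 A, Gbullet n A & V' = change_lift A VM.1).
Proof.
case: VM => V M mP tV; have [/= tVl pV mM] := tV.
have [nV GM E] := (twisted_liftsP n (V, M)).1 tVl.
have [_ PE] := (twisted_lift_ofP (V, M) mP).1 tV; rewrite /= in nV GM E PE.
split=> [[M' [/= tV' pV' mM']]|[A bA ->]].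
  move: pV' mM'; rewrite PE /= => /lift_of_changeP[a Ga V'E] [GM' [c c0 M'E]].
  exists (gauge_of a) => //; apply/Gbullet_gauge_of => //; exists c => // i.
  have [_ _ /(_ i)] := (twisted_liftsP n (V', M')).1 tV'.
  rewrite /= V'E M'E /change_lift /gauge_of /= E -scalemxAl -mulmxA scalemxAr.
  move=> VE; apply: (nondegenerate_inj (i := i + n%:Z) nV).
  by rewrite E -mulmxA VE -!scalemxAr -mulmxA.
have [Ga AE] := GcircP bA.1; rewrite AE in bA *.
have [c c0 aE] := (Gbullet_gauge_of n hN Ga).1 bA.
have GcM : GL _ (c *: M) by rewrite /GL /= unitmxZ ?unitfE.
(* The quasi-period of the gauge transformation rescales the monodromy matrix. *)
exists (c *: M); rewrite PE; split=> /=; last by split=> //; exists c.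
  apply/twisted_liftsP; split=> //=; first exact: nondegenerate_change.
  move=> i; rewrite /change_lift /gauge_of /= aE E -scalemxAr -scalemxAl.
  by rewrite -mulmxA.
by apply/lift_of_changeP; exists (fun i => A (i, bl)).
Qed.

Lemma twisted_lift_of_Gbullet_strictP P V V' M : marked_ngon n P ->
  twisted_lift_of n P (V, M) ->
  (twisted_lift_of n P (V', M) <->
   exists2 A, Gbullet_strict n A & V' = change_lift A V).
Proof.
move=> mP tV; have [/= tVl pV mM] := tV.
have [/= nV GM E] := (twisted_liftsP n (V, M)).1 tVl.
have [_ /= PE] := (twisted_lift_ofP (V, M) mP).1 tV.
split=> [[/= tV' pV' _]|[A sA ->]].
  move: pV'; rewrite PE /= => /lift_of_changeP[a Ga V'E].
  exists (gauge_of a) => //; apply/Gbullet_strict_gauge_of => // i.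
  have [_ _ /(_ i)] := (twisted_liftsP n (V', M)).1 tV'.
  rewrite /= V'E /change_lift /gauge_of /= E -!mulmxA => VE.
  by apply: (nondegenerate_inj (i := i + n%:Z) nV); rewrite E -!mulmxA.
have [Ga AE] := GcircP sA.1; rewrite AE in sA *.
have aE := (Gbullet_strict_gauge_of n Ga).1 sA.
rewrite PE; split=> //=; last exact: pgl_class_refl.
  apply/twisted_liftsP; split=> //=; first exact: nondegenerate_change.
  by move=> i; rewrite /change_lift /gauge_of /= aE E -mulmxA.
by apply/lift_of_changeP; exists (fun i => A (i, bl)).
Qed.

(** * Weights of all lifts of a polygon as gauge classes *)

Definition polygon_weights p : set (weighting R N) :=
  [set w | exists2 V, lift_of p V & weights_of V w].

Definition marked_weights P : set (weighting R N) :=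
  [set w | exists2 VM, twisted_lift_of n P VM & weights_of VM.1 w].

(** The lifts of [p] are exactly the changes of [V] by [Gcirc], and these act on weights by gauge
    transformations. *)
Lemma polygon_weightsE p V : twisted_ngon n p -> lift_of p V ->
  polygon_weights p = quasi_periodic_weights_cls n (lift_weights V).
Proof.
move=> tp pV; have [nV pE] := twisted_ngon_lift tp pV.
apply/seteqP; split=> [w [V' pV' wV']|w [_ [A GA ->]]].
  have [nV' _] := twisted_ngon_lift tp pV'; rewrite -(lift_weightsE nV' wV').
  have /(liftsP _ hn)[_ qV'] : lifts n V' by exists p.
  split=> //; have [A GA ->] := (lift_of_GcircP V' tp pV).1 pV'.
  by exists A => //; exact: lift_weights_change.
exists (change_lift A V); first by apply/(lift_of_GcircP _ tp pV); exists A.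
have [Ga ->] := GcircP GA.
exact/weights_of_change/lift_weightsP.
Qed.

Lemma marked_weightsE P VM : marked_ngon n P -> twisted_lift_of n P VM ->
  marked_weights P = periodic_weights_cls n (lift_weights VM.1).
Proof.
move=> mP tV; have [/twisted_liftsP[nV _ _] _ _] := tV.
apply/seteqP; split=> [w [[V' M'] tV' wV']|w [pw [A bA wE]]].
  have [tVl' _ _] := tV'; have [nV' _ _] := (twisted_liftsP _ _).1 tVl'.
  rewrite -(lift_weightsE nV' wV'); split; first exact: (twisted_lift_weights tVl').
  have [|A bA /= ->] := (twisted_lift_of_GbulletP V' mP tV).1; first by exists M'.
  by exists A => //; apply: lift_weights_change => //; case: bA.
have [|M' tV'] := (twisted_lift_of_GbulletP (change_lift A VM.1) mP tV).2.
  by exists A.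
exists (change_lift A VM.1, M') => //=.
have [Ga AE] := GcircP bA.1; rewrite wE AE.
exact/weights_of_change/lift_weightsP.
Qed.

Lemma strict_weightsE P V M : marked_ngon n P -> twisted_lift_of n P (V, M) ->
  periodic_weights_cls_strict n (lift_weights V) =
  [set w | exists2 V', twisted_lift_of n P (V', M) & weights_of V' w].
Proof.
move=> mP tV; have [/twisted_liftsP[/= nV _ _] _ _] := tV.
apply/esym/seteqP; split=> [w [V' tV' wV']|w [pw [A bA wE]]].
  have [tVl' _ _] := tV'; have [/= nV' _ _] := (twisted_liftsP _ _).1 tVl'.
  rewrite -(lift_weightsE nV' wV'); split; first exact: (twisted_lift_weights tVl').
  have [A bA /= ->] := (twisted_lift_of_Gbullet_strictP V' mP tV).1 tV'.
  by exists A => //; apply: lift_weights_change => //; case: bA.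
exists (change_lift A V).
  by apply/(twisted_lift_of_Gbullet_strictP _ mP tV); exists A.
have [Ga AE] := GcircP bA.1; rewrite wE AE.
exact/weights_of_change/lift_weightsP.
Qed.

(** Equal weight sets provide lifts of the two polygons with the same weights, and such lifts differ
    by some [g], which then carries [p] to [p']. *)
Lemma polygon_weights_eq p p' : twisted_ngon n p -> twisted_ngon n p' ->
  (polygon_weights p = polygon_weights p' <-> pgl_orbit actP p p').
Proof.
move=> tp tp'; have [V pV] := twisted_ngon_has_lift tp.
have [nV pE] := twisted_ngon_lift tp pV; split=> [E|[g Gg p'E]].
  have : polygon_weights p (lift_weights V) by exists V => //; exact: lift_weightsP.
  rewrite E => -[V' pV' wV']; have [nV' p'E] := twisted_ngon_lift tp' pV'.
  have [g Gg V'E] := same_weights nV nV' (lift_weightsP nV) wV'.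
  by exists g; rewrite // p'E V'E pE actP_polygon_of.
have pV' : lift_of p' (actL g V).
  by rewrite p'E pE actP_polygon_of //; exact: lift_of_polygon_of.
by rewrite (polygon_weightsE tp pV) (polygon_weightsE tp' pV') lift_weights_actL.
Qed.

Lemma marked_ngon_actMP g P VM : GL _ g -> marked_ngon n P ->
  twisted_lift_of n P VM ->
  marked_ngon n (actMP g P) /\ twisted_lift_of n (actMP g P) (actTL g VM).
Proof.
case: VM => V M Gg mP tV; have [tVl ->] := (twisted_lift_ofP _ mP).1 tV.
have [_ GM _] := (twisted_liftsP _ _).1 tVl.
rewrite actMP_polygon_of //.
exact: (twisted_lift_marked (twisted_lifts_actTL Gg tVl)).
Qed.

Lemma marked_weights_eq P P' : marked_ngon n P -> marked_ngon n P' ->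
  (marked_weights P = marked_weights P' <-> pgl_orbit actMP P P').
Proof.
move=> mP mP'; have [VM tV] := marked_ngon_has_lift hn mP.
have [tVl PE] := (twisted_lift_ofP _ mP).1 tV.
have [nV GM _] := (twisted_liftsP _ _).1 tVl.
split=> [E|[g Gg P'E]].
  have : marked_weights P (lift_weights VM.1) by exists VM => //; exact: lift_weightsP.
  rewrite E => -[VM' tV' wV']; have [tVl' P'E] := (twisted_lift_ofP _ mP').1 tV'.
  have [nV' _ _] := (twisted_liftsP _ _).1 tVl'.
  have [|g Gg VM'E] := (twisted_lifts_eq tVl tVl').1.
    by rewrite (lift_weightsE nV' wV').
  by exists g; rewrite // P'E VM'E PE actMP_polygon_of.
have [_] := marked_ngon_actMP Gg mP tV; rewrite -P'E => tV'.
by rewrite (marked_weightsE mP tV) (marked_weightsE mP' tV') lift_weights_actL.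
Qed.

Lemma strict_weights_eq VM VM' : twisted_lifts n VM -> twisted_lifts n VM' ->
  (periodic_weights_cls_strict n (lift_weights VM.1) =
   periodic_weights_cls_strict n (lift_weights VM'.1) <->
   linear_equiv n VM VM').
Proof.
case: VM VM' => V M [V' M'] tV tV'; rewrite /linear_equiv /=.
have [/= mP tP] := twisted_lift_marked tV.
have [/= mP' tP'] := twisted_lift_marked tV'.
have [/= nV GM _] := (twisted_liftsP _ _).1 tV.
have [/= nV' _ _] := (twisted_liftsP _ _).1 tV'.
split=> [|[g Gg [M'E [p [tp pV pV']]]]].
  rewrite (strict_weightsE mP tP) (strict_weightsE mP' tP') => E.
  have : [set w | exists2 V0, twisted_lift_of n (polygon_of V', pgl_class M') (V0, M')
      & weights_of V0 w] (lift_weights V').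
    by exists V' => //; exact: lift_weightsP.
  (* [V0] lifts the polygon of [V], keeps its matrix [M] and has the weights of [V'], so a single
     [g] relates it to [V']. *)
  rewrite -E => -[V0 tV0 wV0].
  have [tV0l [PE]] := (twisted_lift_ofP _ mP).1 tV0.
  have [/= nV0 _ _] := (twisted_liftsP _ _).1 tV0l.
  have [|g Gg [V'E M'E]] := (twisted_lifts_eq tV0l tV').1.
    by rewrite /= (lift_weightsE nV0 wV0).
  exists g => //; split=> //; exists (polygon_of V'); split.
  - by case: mP'.
  - by rewrite V'E -actP_polygon_of // -PE actP_polygon_of //; exact: lift_of_polygon_of.
  - exact: lift_of_polygon_of.
(* Conversely, [actTL g (V, M)] and (V', M') are twisted lifts of one marked polygon with the same
   matrix. *)
have [mg tg] := marked_ngon_actMP Gg mP tP.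
have [_ pE] := twisted_ngon_lift tp pV; have [_ pE'] := twisted_ngon_lift tp pV'.
have tg' : twisted_lift_of n (polygon_of V', pgl_class M') (actTL g (V, M)).
  by move: tg; rewrite actMP_polygon_of // -M'E -pE pE'.
rewrite -(lift_weights_actL Gg nV) (strict_weightsE mP' tP').
by rewrite M'E in mP' tg' *; exact: (strict_weightsE mP' tg').
Qed.

(** * The bijections on quotients *)

Lemma bij_twisted_lifts : exists fa,
  set_bij (@twisted_lifts_modPGL R N n) (periodic_weights n) fa /\
  forall VM, twisted_lifts n VM -> fa (twisted_lift_cls n VM) = lift_weights VM.1.
Proof.
apply: (quot_quot_bij (fun=> 0) (act := actTL)
  (f := fun VM => lift_weights VM.1)).
- by move=> VM _; split=> //; exact: dilation_refl.
- move=> VM VM' /twisted_liftsP[nV _ _] _ [/dilation_actL[g Gg ->] _].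
  by rewrite lift_weights_actL.
- by move=> g VM; exact: twisted_lifts_actTL.
- by move=> g [V M] [V' M'] [/= d ->]; split=> //; exact: actL_dilation.
- move=> g VM Gg; rewrite -{1}[g]invmxK actTLK //.
  by rewrite /GL /= unitmx_inv.
- by move=> g VM; exact: actTLK.
- exact: twisted_lift_weights.
- exact: periodic_weights_lift.
- exact: twisted_lifts_eq.
Qed.

(** Stated for a general [W] in order to cover both quasi-periodic and arbitrary weights. *)
Lemma bij_lifts (L : set (lift_seq R N)) (W : set (weighting R N)) :
  (forall V, L V <-> nondegenerate V /\ W (lift_weights V)) ->
  W `<=` all_weights ->
  exists f, set_bij (quot (quot L dilation) (pgl_orbit_cls actL)) W f /\
  forall V, L V ->
    f (cls (quot L dilation) (pgl_orbit_cls actL) (cls L dilation V)) = lift_weights V.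
Proof.
move=> LP Wa; apply: (quot_quot_bij (fun=> 0) (act := actL) (f := lift_weights)).
- by move=> V _; exact: dilation_refl.
- by move=> V V' /LP[nV _] _ /dilation_actL[g Gg ->]; rewrite lift_weights_actL.
- move=> g V Gg /LP[nV WV]; apply/LP; rewrite lift_weights_actL //.
  by split=> //; exact: nondegenerate_actL.
- by move=> g V V'; exact: actL_dilation.
- move=> g V Gg; rewrite -{1}[g]invmxK actLK //.
  by rewrite /GL /= unitmx_inv.
- by move=> g V; exact: actLK.
- by move=> V /LP[].
- move=> w Ww; have [V nV wV] := exists_lift (Wa w Ww).
  by exists V; [apply/LP; rewrite (lift_weightsE nV wV)|exact: lift_weightsE].
- by move=> V V' /LP[nV _] /LP[nV' _]; exact: lift_weights_eq.
Qed.

Lemma bij_GP : exists F, set_bij (@GP R N n) (periodic_weights_modG n) F /\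
  forall P, marked_ngon n P -> F (GP_cls n P) = marked_weights P.
Proof.
apply: (quot_bij set0).
- move=> P mP; have [VM tV] := marked_ngon_has_lift hn mP.
  rewrite (marked_weightsE mP tV); exists (lift_weights VM.1) => //.
  by apply: twisted_lift_weights; case: tV.
- move=> _ [w pw <-]; have [VM tV <-] := periodic_weights_lift pw.
  have [mP tP] := twisted_lift_marked tV; eexists; first exact: mP.
  exact: marked_weightsE.
- exact: marked_weights_eq.
Qed.

Lemma bij_bareGP : exists K,
  set_bij (@bareGP R N n) (quasi_periodic_weights_modG n) K /\
  forall p, twisted_ngon n p -> K (bareGP_cls n p) = polygon_weights p.
Proof.
apply: (quot_bij set0).
- move=> p tp; have [V pV] := twisted_ngon_has_lift tp.
  rewrite (polygon_weightsE tp pV); exists (lift_weights V) => //.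
  by have /(liftsP _ hn)[] : lifts n V by exists p.
- move=> _ [w qw <-]; have [V nV wV] := exists_lift qw.1.
  rewrite -(lift_weightsE nV wV) in qw *.
  have [p tp pV] : lifts n V by apply/liftsP.
  by exists p => //; exact: polygon_weightsE.
- exact: polygon_weights_eq.
Qed.

Lemma bij_linearGP : exists G,
  set_bij (@linearGP R N n) (periodic_weights_modG_strict n) G /\
  forall VM, twisted_lifts n VM -> G (linearGP_cls n VM) =
    periodic_weights_cls_strict n (lift_weights VM.1).
Proof.
apply: (quot_bij set0).
- by move=> VM tV; exists (lift_weights VM.1) => //; exact: twisted_lift_weights.
- by move=> _ [w pw <-]; have [VM tV <-] := periodic_weights_lift pw; exists VM.
- exact: strict_weights_eq.
Qed.

(** Weights related by [Gbullet] come from lifts of one polygon, so they lie in the same class under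
    [Gcirc]. *)
Lemma periodic_to_quasi : exists H : set (weighting R N) -> set (weighting R N),
  forall w, periodic_weights n w ->
    H (periodic_weights_cls n w) = quasi_periodic_weights_cls n w.
Proof.
have lw w : periodic_weights n w -> exists VM P, [/\ twisted_lifts n VM,
    lift_weights VM.1 = w, marked_ngon n P & twisted_lift_of n P VM].
  move=> /periodic_weights_lift[VM tV wE]; have [mP tP] := twisted_lift_marked tV.
  by exists VM, (polygon_of VM.1, pgl_class VM.2).
apply: (quot_factor set0) => [w pw|w w' pw pw' [A bA ->]].
  have [[V M] [P [tV <- mP tP]]] := lw w pw.
  (* Reflexivity: [V] is a twisted lift of its own marked polygon, hence a change of itself by an
     element of [Gbullet]. *)
  have [|A bA /= VE] := (twisted_lift_of_GbulletP V mP tP).1; first by exists M.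
  have [nV _ _] := (twisted_liftsP _ _).1 tV.
  by exists A => //=; rewrite -lift_weights_change -?VE //; case: bA.
have [[V M] [P [tV <- mP [_ /= pV _]]]] := lw w pw.
have [nV _ _] := (twisted_liftsP _ _).1 tV.
have pV' : lift_of P.1 (change_lift A V).
  by apply/(lift_of_GcircP _ mP.1 pV); exists A => //; case: bA.
rewrite -lift_weights_change //; last by case: bA.
by rewrite -(polygon_weightsE mP.1 pV) -(polygon_weightsE mP.1 pV').
Qed.

Lemma lifts_change V A : lifts n V -> Gcirc A -> lifts n (change_lift A V).
Proof.
by move=> [p tp pV] GA; exists p => //; apply/(lift_of_GcircP _ tp pV); exists A.
Qed.

(** On rigid polygons the monodromy is a function of the polygon, so forgetting it loses nothing. *)
Lemma bij_rigid (F : set (polygon R N * set 'M[R]_(N + N + N)) -> set (weighting R N))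
    (K : set (polygon R N) -> set (weighting R N))
    (H : set (weighting R N) -> set (weighting R N)) :
  (forall P, marked_ngon n P -> F (GP_cls n P) = marked_weights P) ->
  (forall p, twisted_ngon n p -> K (bareGP_cls n p) = polygon_weights p) ->
  (forall P, marked_ngon n P -> H (F (GP_cls n P)) = K (bareGP_cls n P.1)) ->
  set_bij (F @` GP_rigid n) (K @` bareGP_rigid n) H.
Proof.
move=> FE KE HE; split.
- move=> _ [_ [[P mP <-] rP] <-]; rewrite /= HE //.
  exists (bareGP_cls n P.1) => //; split; first by exists P.1 => //; case: mP.
  (* Rigidity is required of every representative, so each translate by [g] is lifted to a marked
     polygon in the class of [P]. *)
  move=> _ [_ [g Gg ->]]; have [VM tV] := marked_ngon_has_lift hn mP.
  have [mgP _] := marked_ngon_actMP Gg mP tV.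
  by apply: (rP (actMP g P)); split=> //; exists g.
- move=> _ _ /set_mem[_ [[P mP <-] _] <-] /set_mem[_ [[P' mP' <-] rP'] <-].
  rewrite !HE // !KE ?mP.1 ?mP'.1 //; try by case: mP; case: mP'.
  move=> /(polygon_weights_eq mP.1 mP'.1)[g Gg P'1].
  rewrite !FE //; apply/marked_weights_eq => //; exists g => //.
  have [VM tV] := marked_ngon_has_lift hn mP.
  have [mgP _] := marked_ngon_actMP Gg mP tV.
  have /rP' r : GP_cls n P' P'.
    by split=> //; apply/marked_weights_eq.
  (* Both sides are monodromies of the rigid polygon [P'.1]. *)
  have P'2 : P'.2 = (actMP g P).2.
    by apply: r; [exact: mP'.2|rewrite P'1; exact: mgP.2].
  by rewrite [LHS]surjective_pairing P'1 P'2.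
- move=> _ [_ [[p tp <-] rp] <-]; have [_ [m pm] _] := tp.
  have mP : marked_ngon n (p, m) by [].
  exists (F (GP_cls n (p, m))); last by rewrite HE.
  exists (GP_cls n (p, m)) => //; split; first by exists (p, m).
  move=> P' [mgP [g Gg PE]]; apply: rp; split; first by case: mgP.
  by exists g; rewrite // PE.
Qed.

End Correspondence.

(** * Lifts, weights and moduli of polygons brought together *)

Theorem theorem3 (R : realType) (N n : nat) (hN : (0 < N)%N) (hn : (0 < n)%N) :
  (exists (fa : set (set (lift_seq R N * 'M[R]_(N + N + N))) -> weighting R N)
          (fb finf : set (set (lift_seq R N)) -> weighting R N),
    [/\ (* (a) *)
        set_bij (twisted_lifts_modPGL n) (periodic_weights n) fa /\
        (forall VM : lift_seq R N * 'M[R]_(N + N + N), twisted_lifts n VM ->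
           weights_of VM.1 (fa (twisted_lift_cls n VM))),
        (* (b), for lifts of twisted n-gons and for arbitrary sequences *)
        [/\ set_bij (lifts_modPGL n) (quasi_periodic_weights n) fb,
            (forall V : lift_seq R N, lifts n V ->
               weights_of V (fb (lift_cls n V))),
            set_bij all_lifts_modPGL all_weights finf &
            (forall V : lift_seq R N, all_lifts V ->
               weights_of V (finf (all_lift_cls V)))],
        (* (c), infinite network *)
        (forall (p : polygon R N) (V V' : lift_seq R N),
           twisted_ngon n p -> lift_of p V ->
           (lift_of p V' <-> exists2 A, Gcirc A & V' = change_lift A V)) /\
        (forall (V : lift_seq R N) (A : gauge R N), lifts n V -> Gcirc A ->
           fb (lift_cls n (change_lift A V)) =
           gauge_act A (fb (lift_cls n V))) &
        (* (c), periodic network *)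
        [/\ (forall (P : polygon R N * set 'M[R]_(N + N + N))
                    (VM : lift_seq R N * 'M[R]_(N + N + N)) (V' : lift_seq R N),
               marked_ngon n P -> twisted_lift_of n P VM ->
               ((exists M', twisted_lift_of n P (V', M')) <->
                exists2 A, Gbullet n A & V' = change_lift A VM.1)),
            (forall (P : polygon R N * set 'M[R]_(N + N + N))
                    (V V' : lift_seq R N) (M : 'M[R]_(N + N + N)),
               marked_ngon n P -> twisted_lift_of n P (V, M) ->
               (twisted_lift_of n P (V', M) <->
                exists2 A, Gbullet_strict n A & V' = change_lift A V)) &
            (forall (V : lift_seq R N) (M M' : 'M[R]_(N + N + N))
                    (A : gauge R N),
               twisted_lifts n (V, M) ->
               twisted_lifts n (change_lift A V, M') -> Gbullet n A ->
               fa (twisted_lift_cls n (change_lift A V, M')) =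
               gauge_act A (fa (twisted_lift_cls n (V, M))))]])
  /\
  (* (d) *)
  (exists (F : set (polygon R N * set 'M[R]_(N + N + N)) ->
               set (weighting R N))
          (K : set (polygon R N) -> set (weighting R N))
          (H : set (weighting R N) -> set (weighting R N)),
    [/\ set_bij (GP n) (periodic_weights_modG n) F /\
        (forall P : polygon R N * set 'M[R]_(N + N + N), marked_ngon n P ->
           F (GP_cls n P) =
           [set w | exists2 VM, twisted_lift_of n P VM & weights_of VM.1 w]),
        set_bij (bareGP n) (quasi_periodic_weights_modG n) K /\
        (forall p : polygon R N, twisted_ngon n p ->
           K (bareGP_cls n p) =
           [set w | exists2 V, lift_of p V & weights_of V w]),
        set_surj (periodic_weights_modG n) (quasi_periodic_weights_modG n) H /\
        (forall w : weighting R N, periodic_weights n w ->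
           H (periodic_weights_cls n w) = quasi_periodic_weights_cls n w),
        (forall P : polygon R N * set 'M[R]_(N + N + N), marked_ngon n P ->
           H (F (GP_cls n P)) = K (bareGP_cls n P.1)) &
        set_bij (F @` GP_rigid n) (K @` bareGP_rigid n) H])
  /\
  (* (d), for the monodromy in GL and strictly periodic gauge transformations *)
  (exists G : set (lift_seq R N * 'M[R]_(N + N + N)) -> set (weighting R N),
     set_bij (linearGP n) (periodic_weights_modG_strict n) G /\
     (forall (VM : lift_seq R N * 'M[R]_(N + N + N)) (w : weighting R N),
        twisted_lifts n VM -> weights_of VM.1 w ->
        G (linearGP_cls n VM) = periodic_weights_cls_strict n w)).
Proof.
split; first last.
  split; last first.
    have [G [Gbij GE]] := @bij_linearGP R N n.
    exists G; split=> // VM w tV wV; have [nV _ _] := (twisted_liftsP _ _).1 tV.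
    by rewrite GE // (lift_weightsE nV wV).
  have [F [Fbij FE]] := @bij_GP R N n hN hn.
  have [K [Kbij KE]] := @bij_bareGP R N n hn.
  have [H HE] := @periodic_to_quasi R N n hN hn.
  (* A twisted lift of [P] is also a lift of [P.1], so both sides are the class of its weights. *)
  have HFK P : marked_ngon n P -> H (F (GP_cls n P)) = K (bareGP_cls n P.1).
    move=> mP; have [VM tV] := marked_ngon_has_lift hn mP.
    have [tVl pV _] := tV; rewrite FE // KE; last by case: mP.
    rewrite (marked_weightsE hN mP tV) HE; last exact: twisted_lift_weights.
    by rewrite (polygon_weightsE hn mP.1 pV).
  exists F, K, H; split=> //; last exact: bij_rigid FE KE HFK.
  (* Surjectivity of [H]: [w] and the periodic [w'] in its orbit are weights of two lifts of one
     polygon, so their classes under [Gcirc] coincide. *)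
  split=> // _ [w [aw [w' pw' [A GA w'E]]] <-].
  exists (periodic_weights_cls n w'); first by exists w'.
  rewrite HE // w'E; have [V nV wV] := exists_lift aw.
  have /liftsP-/(_ hn) lV : nondegenerate V /\ quasi_periodic_weights n (lift_weights V).
    by rewrite (lift_weightsE nV wV); split=> //; split=> //; exists w' => //; exists A.
  have [p tp pV] := lV; have pV' := (lift_of_GcircP _ tp pV).2 (ex_intro2 _ _ A GA erefl).
  rewrite -(lift_weightsE nV wV) -lift_weights_change //.
  exact: etrans (esym (polygon_weightsE hn tp pV')) (polygon_weightsE hn tp pV).
have [fa [fabij faE]] := @bij_twisted_lifts R N n.
have qa : quasi_periodic_weights n `<=` @all_weights R N by move=> w [].
have [fb [fbbij fbE]] := bij_lifts (fun V => liftsP V hn) qa.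
have aP (V : lift_seq R N) :
    all_lifts V <-> nondegenerate V /\ all_weights (lift_weights V).
  by split=> [nV|[]//]; split=> //; case: (lift_weightsP nV).
have [finf [finfbij finfE]] := bij_lifts aP (@subset_refl _ _).
exists fa, fb, finf; split.
- split=> // VM tV; rewrite faE //; apply: lift_weightsP.
  by case/twisted_liftsP: tV.
- split=> //.
    by move=> V lV; rewrite fbE //; apply/lift_weightsP; exact: lifts_nondegenerate lV.
  by move=> V lV; rewrite finfE //; exact: lift_weightsP.
- split; first exact: lift_of_GcircP.
  move=> V A lV GA; rewrite !fbE //; last exact: lifts_change.
  by apply: lift_weights_change => //; exact: lifts_nondegenerate lV.
- split.
  + by move=> P VM V' mP; exact: twisted_lift_of_GbulletP.
  + by move=> P V V' M mP; exact: twisted_lift_of_Gbullet_strictP.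
  + move=> V M M' A tV tV' bA; rewrite !faE //=.
    have [nV _ _] := (twisted_liftsP _ _).1 tV.
    by apply: lift_weights_change => //; case: bA.
Qed.
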